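(* Let $K$ be a field and let $I\subset S=K[t_1,\ldots,t_s]$ be an ideal. If $\mathrm{Ass}(I^n)\subset\mathrm{Ass}(I)$ for some $n\geq 1$, then $I^{\langle n\rangle}=I^n$ (for that $n$). In particular, if $I$ is normally torsion-free, then $I^{\langle n\rangle}=I^n$ for all $n\geq 1$.
   Context: $\mathrm{Ass}(I)$ is the set of associated primes of $I$, i.e. primes of the form $(I\colon f)$, $f\in S$. For $n\geq 1$, $I^{\langle n\rangle}:=\bigcap_{\mathfrak{p}\in\mathrm{Ass}(I)}(I^nS_{\mathfrak{p}}\cap S)$. The ideal $I$ is normally torsion-free if $\mathrm{Ass}(I^n)\subset\mathrm{Ass}(I)$ for all $n\geq 1$. *)

(* Defs.v *)
From mathcomp Require Import all_boot all_order all_algebra.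
From mathcomp Require Import mpoly.
From mathcomp Require Import boolp classical_sets.

Set Implicit Arguments.
Unset Strict Implicit.
Unset Printing Implicit Defensive.

Import GRing.Theory.
Local Open Scope ring_scope.
Local Open Scope classical_set_scope.

(* Ideals are arbitrary [Prop]-valued subsets, and may be zero or the whole
   ring: the [idealr] structure of [ring_quotient] only covers decidable proper
   ideals. *)
Section Ideals.
Variable R : comNzRingType.
Implicit Types (I p A G : set R) (f x : R) (n : nat).

Definition ideal I : Prop :=
  [/\ I 0, forall x y, I x -> I y -> I (x + y) & forall a x, I x -> I (a * x)].

Definition prime_ideal p : Prop :=
  [/\ ideal p, ~ p 1 & forall x y, p (x * y) -> p x \/ p y].

(* Finite linear combinations of elements of G with coefficients in A. *)
Definition lincomb A G : set R :=
  [set x | exists k (a g : 'I_k -> R),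
    [/\ forall i, A (a i), forall i, G (g i) & x = \sum_(i < k) a i * g i]].

Definition ideal_gen G : set R := lincomb setT G.

Definition ideal_pow I n : set R :=
  ideal_gen [set x | exists2 f : 'I_n -> R,
    forall i, I (f i) & x = \prod_(i < n) f i].

Definition colon I f : set R := [set x | I (x * f)].

Definition Ass I : set (set R) :=
  [set p | prime_ideal p /\ exists f, p = colon I f].

Definition normally_torsion_free I : Prop :=
  forall n, (1 <= n)%N -> Ass (ideal_pow I n) `<=` Ass I.

End Ideals.

(* For a domain R, the localization R_p is realized as a subring of the
   fraction field of R, so that contraction to R is the preimage under
   [tofrac]. *)
Section Localization.
Variable R : idomainType.
Implicit Types (I J p : set R) (n : nat).

Definition localization p : set {fraction R} :=
  [set x | exists a b : R, ~ p b /\ x = tofrac a / tofrac b].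

(* The ideal J R_p of R_p. *)
Definition loc_ext J p : set {fraction R} :=
  lincomb (localization p) (@tofrac R @` J).

(* The intersection is the whole ring when [Ass I] is empty, in
   particular for I = R. *)
Definition symbolic_pow I n : set R :=
  \bigcap_(p in Ass I) (@tofrac R @^-1` loc_ext (ideal_pow I n) p).

End Localization.

(* Main.v *)
Require Import Defs.
From mathcomp Require Import all_boot all_order all_algebra.
From mathcomp Require Import mpoly ring.
From mathcomp Require Import boolp classical_sets.

(** Write J for I^n.  The inclusion of J in the symbolic power is clear, as
    J is contained in the contraction of J S_p for every prime p.

    Conversely, let x lie in the symbolic power and suppose that x is not in J.
    As S is Noetherian, x has a multiple xy outside J whose colon ideal
    p = (J : xy) is prime ([exists_prime_colon]): if no such colon ideal were
    prime, each could be strictly enlarged by passing to a further multiple of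
    xy outside J.  Then p is associated to J, hence to I by hypothesis, so x
    lies in J S_p; clearing denominators, bx lies in J for some b outside p
    ([loc_ext_tofrac]).  But then bxy lies in J, that is, b lies in p: a
    contradiction.

    The ascending chain condition for polynomial rings over a field is obtained
    from leading monomials ([mpoly_acc]).  In a strictly ascending chain J_0,
    J_1, ... pick f_k in J_(k+1) but not in J_k with the smallest possible
    leading monomial.  By Dickson's lemma ([dickson]) the leading monomial of
    some f_i divides that of some f_j with i < j; cancelling the leading term of
    f_j against a multiple of f_i gives a smaller choice for f_j. *)

Set Implicit Arguments.
Unset Strict Implicit.
Unset Printing Implicit Defensive.

Import Order.TTheory GRing.Theory.
Local Open Scope ring_scope.
Local Open Scope classical_set_scope.

Lemma nat_nondecreasing_subseq (u : nat -> nat) :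
  exists2 phi : nat -> nat, {homo phi : i j / (i < j)%N} &
    {homo u \o phi : i j / (i <= j)%N}.
Proof.
have tail_min N : exists k, (N <= k)%N /\ forall j, (N <= j)%N -> (u k <= u j)%N.
  have ex_val : exists v, `[< exists2 k, (N <= k)%N & u k = v >].
    by exists (u N); apply/asboolP; exists N.
  case: (ex_minnP ex_val) => v /asboolP[k leNk <-] min_v.
  by exists k; split=> // j leNj; apply: min_v; apply/asboolP; exists j.
have [g gP] := choice tail_min.
pose phi n := iter n (fun k => g k.+1) (g 0%N).
(* Every [phi n] is the position of the minimum of some tail of [u]. *)
have phi_min n : exists N, phi n = g N.
  by case: n => [|n]; [exists 0%N | exists (phi n).+1].
have phi_lt n : (phi n < phi n.+1)%N by have [] := gP (phi n).+1.
exists phi; first exact: homo_ltn ltn_trans phi_lt.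
apply: homo_leq leqnn leq_trans _ => n /=.
have [N eN] := phi_min n; have [leNg min_g] := gP N.
rewrite {1}eN; apply: min_g; apply: leq_trans leNg _.
by rewrite -eN ltnW.
Qed.

(** Passing to a further subsequence for each index in turn keeps the monotonicity
    already obtained. *)
Lemma common_nondecreasing_subseq (I : eqType) (r : seq I) (u : I -> nat -> nat) :
  exists2 phi : nat -> nat, {homo phi : i j / (i < j)%N} &
    forall a, a \in r -> {homo u a \o phi : i j / (i <= j)%N}.
Proof.
elim: r => [|a r [phi phi_lt phi_le]]; first by exists id.
have [psi psi_lt psi_le] := nat_nondecreasing_subseq (u a \o phi).
exists (phi \o psi) => [i j ltij|b]; first exact/phi_lt/psi_lt.
rewrite inE => /predU1P[-> //|b_r] i j leij; apply: phi_le => //.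
exact: ltW_homo psi_lt _ _ leij.
Qed.

Lemma dickson (s : nat) (m : nat -> 'X_{1..s}) :
  exists i j, (i < j)%N /\ (m i <= m j)%MM.
Proof.
have [phi phi_lt phi_le] :=
  common_nondecreasing_subseq (enum 'I_s) (fun a n => m n a).
exists (phi 0%N), (phi 1%N); split; first exact: phi_lt.
by apply/mnm_lepP => a; apply: (phi_le a) => //; rewrite mem_enum.
Qed.

Definition ascending_chain_condition (R : comNzRingType) : Prop :=
  forall J : nat -> set R, (forall n, ideal (J n)) ->
    (forall n, J n `<=` J n.+1) -> exists n, J n.+1 `<=` J n.

Lemma exists_min_mlead (K : fieldType) (s : nat) (P : set {mpoly K[s]}) f :
  P f -> exists2 g, P g & forall h, P h -> (mlead g <= mlead h)%O.
Proof.
elim/mleadrect: f => f ih Pf.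
have [[g [Pg ltgf]]|no_less] := pselect (exists g, P g /\ (mlead g < mlead f)%O).
  exact: ih ltgf Pg.
exists f => // h Ph; rewrite leNgt; apply/negP => lthf.
by apply: no_less; exists h.
Qed.

(** This is one step of the division algorithm: [a] is the quotient of the leading
    terms, so the two leading terms cancel. *)
Lemma cancel_mlead (K : fieldType) (s : nat) (f g : {mpoly K[s]}) :
  f != 0 -> g != 0 -> (mlead f <= mlead g)%MM ->
  exists a, g - a * f != 0 -> (mlead (g - a * f) < mlead g)%O.
Proof.
move=> f0 g0 lefg; pose c := mleadc g / mleadc f.
have c0 : c != 0 by rewrite mulf_neq0 ?invr_eq0 ?mleadc_eq0.
pose a : {mpoly K[s]} := c *: 'X_[mlead g - mlead f].
have a_lead : mlead a = (mlead g - mlead f)%MM by rewrite mleadZ // mleadXm.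
have a0 : a != 0 by rewrite -mleadc_eq0 a_lead mcoeffZ mcoeffX eqxx mulr1.
have af_lead : mlead (a * f) = mlead g by rewrite mleadM // a_lead submK.
exists a => d0; rewrite lt_neqAle; apply/andP; split; last first.
  by apply: le_trans (mleadB_le _ _) _; rewrite af_lead joinxx.
apply: contra_neq d0 => e; apply/eqP; rewrite -mleadc_eq0 e mcoeffB.
rewrite -[in X in _ - X]af_lead mleadM // mleadcM a_lead mcoeffZ mcoeffX eqxx.
by rewrite mulr1 divfK ?subrr // mleadc_eq0.
Qed.

Lemma mpoly_acc (K : fieldType) (s : nat) :
  ascending_chain_condition {mpoly K[s]}.
Proof.
move=> J idJ ascJ; apply: contrapT => strictJ.
have monJ i j : (i <= j)%N -> J i `<=` J j.
  move=> leij; rewrite -(subnK leij); elim: (j - i)%N => // k ih f Jf.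
  exact/ascJ/ih.
have step n : exists f, [/\ J n.+1 f, ~ J n f &
    forall h, J n.+1 h -> ~ J n h -> (mlead f <= mlead h)%O].
  have /existsNP[f /not_implyP[Jf nJf]] : ~ (J n.+1 `<=` J n).
    by move=> le; apply: strictJ; exists n.
  have [g [Jg nJg] min_g] :=
    exists_min_mlead (P := [set h | J n.+1 h /\ ~ J n h]) (conj Jf nJf).
  by exists g; split=> // h Jh nJh; apply: min_g.
have [f fP] := choice step.
have nz n : f n != 0.
  have [_ nJ _] := fP n; apply/eqP => f0; apply: nJ; rewrite f0.
  by have [] := idJ n.
have [i [j [ltij le_m]]] := dickson (fun n => mlead (f n)).
have [a lt_lead] := cancel_mlead (nz i) (nz j) le_m.
have [Jfi _ _] := fP i; have [Jfj nJfj min_fj] := fP j.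
have [_ addJ mulJ] := idJ j; have [_ addJ1 mulJ1] := idJ j.+1.
have Jafi : J j (a * f i) by apply: mulJ; apply: monJ ltij _ Jfi.
have nJd : ~ J j (f j - a * f i).
  by move=> Jd; apply: nJfj; rewrite -(subrK (a * f i) (f j)); apply: addJ.
have Jd : J j.+1 (f j - a * f i).
  apply: addJ1 => //; rewrite -mulN1r; apply: mulJ1; exact: ascJ.
have d0 : f j - a * f i != 0.
  by apply/eqP => d0; apply: nJd; rewrite d0; have [] := idJ j.
by have := lt_lead d0; rewrite ltNge min_fj.
Qed.

Lemma ideal_colon (R : comNzRingType) (J : set R) f :
  ideal J -> ideal (colon J f).
Proof.
move=> [J0 JD JM]; split; rewrite /colon /=; first by rewrite mul0r.
- by move=> x y Jx Jy; rewrite mulrDl; apply: JD.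
- by move=> a x Jx; rewrite -mulrA; apply: JM.
Qed.

(** If (J : xy) is not prime, say ab lies in it but a and b do not, then
    (J : xya) is strictly larger, as it contains b; and xya is still outside J, as
    a is not in (J : xy).  Iterating contradicts the chain condition. *)
Lemma exists_prime_colon (R : comNzRingType) (J : set R) x :
  ascending_chain_condition R -> ideal J -> ~ J x ->
  exists y, prime_ideal (colon J (x * y)).
Proof.
move=> accR idJ nJx; apply: contrapT => noprime; have [J0 JD JM] := idJ.
have step y : exists a, ~ J (x * y) ->
    ~ J (x * (y * a)) /\ ~ (colon J (x * (y * a)) `<=` colon J (x * y)).
  have [Jxy|nJxy] := pselect (J (x * y)); first by exists 0.
  apply: contrapT => stuck; apply: noprime; exists y; split.
  - exact: ideal_colon.
  - by rewrite /colon /= mul1r.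
  - move=> a b Jab; apply: contrapT => /not_orP[nJa nJb].
    apply: stuck; exists a => _; split; first by rewrite mulrA (mulrC _ a).
    move=> le; apply: nJb; apply: le; rewrite /colon /=.
    by have -> : b * (x * (y * a)) = a * b * (x * y) by ring.
have [g gP] := choice step.
pose y n := iter n (fun z => z * g z) 1.
have nJ n : ~ J (x * y n).
  elim: n => [|n ih]; first by rewrite mulr1.
  by have [] := gP _ ih.
have [||n] := accR (fun n => colon J (x * y n)).
- by move=> n; apply: ideal_colon.
- move=> n a; rewrite /colon /= => Ja.
  by rewrite !mulrA (mulrC _ (g _)) -(mulrA a); apply: JM.
- by have [_ nle] := gP _ (nJ n).
Qed.

Lemma ideal_ideal_gen (R : comNzRingType) (G : set R) : ideal (ideal_gen G).
Proof.
split.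
- by exists 0%N, (fun=> 0), (fun=> 0); split; [move=> [] | move=> [] | rewrite big_ord0].
- move=> _ _ [k [a [g [_ Gg ->]]]] [l [b [h [_ Gh ->]]]].
  exists (k + l)%N, (fun i => match split i with inl i => a i | inr i => b i end),
    (fun i => match split i with inl i => g i | inr i => h i end); split=> //.
  + by move=> i; case: (split i).
  + rewrite big_split_ord /=; congr (_ + _); apply: eq_bigr => i _.
      by case: (split_ordP (lshift l i)) => j /eqP;
        rewrite ?eq_lshift ?eq_lrshift // => /eqP ->.
    by case: (split_ordP (rshift k i)) => j /eqP;
      rewrite ?eq_rshift ?eq_rlshift // => /eqP ->.
- move=> c _ [k [a [g [_ Gg ->]]]].
  exists k, (fun i => c * a i), g; split=> //.
  by rewrite mulr_sumr; apply: eq_bigr => i _; rewrite mulrA.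
Qed.

(** Every element z of J R_p satisfies bz = c with b outside p and c in J: this
    holds for each term of a linear combination, and passes to sums by taking the
    product of the denominators, which avoids p as p is prime.  Partial sums need
    not lie in R, so the induction is over z in the fraction field. *)
Lemma loc_ext_tofrac (R : idomainType) (J p : set R) x :
  ideal J -> prime_ideal p -> loc_ext J p (tofrac x) ->
  exists2 b, ~ p b & J (b * x).
Proof.
move=> [J0 JD JM] [[p0 _ _] p1 pM] [k [a [g [loc_a J_g x_sum]]]].
have nz b : ~ p b -> tofrac b != 0.
  by move=> pb; rewrite tofrac_eq0; apply/eqP => b0; apply: pb; rewrite b0.
have pMn b c : ~ p b -> ~ p c -> ~ p (b * c) by move=> pb pc /pM[].
suff [b [c [pb Jc e]]] :
    exists b c, [/\ ~ p b, J c & \sum_(i < k) a i * g i * tofrac b = tofrac c].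
  exists b => //; suff -> : b * x = c by [].
  by apply/eqP; rewrite -tofrac_eq tofracM x_sum mulrC mulr_suml e.
under eq_exists => b do under eq_exists => c do rewrite -mulr_suml.
apply: (big_ind (fun z => exists b c, [/\ ~ p b, J c & z * tofrac b = tofrac c])).
- by exists 1, 0; split; rewrite ?mul0r ?tofrac0.
- move=> z w [b [c [pb Jc ez]]] [d [e [pd Je ew]]].
  exists (b * d), (d * c + b * e); split; [exact: pMn | by apply: JD; apply: JM |].
  by rewrite tofracD !tofracM -ez -ew; ring.
- move=> i _; have [u [v [pv ->]]] := loc_a i; have [h Jh <-] := J_g i.
  exists v, (u * h); split=> //; first exact: JM.
  by rewrite tofracM; field; exact: nz.
Qed.

Theorem proposition5p6 (K : fieldType) (s : nat) (I : set {mpoly K[s]})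
    (hI : ideal I) :
  (forall n : nat, (1 <= n)%N ->
     Ass (ideal_pow I n) `<=` Ass I -> symbolic_pow I n = ideal_pow I n) /\
  (normally_torsion_free I ->
     forall n : nat, (1 <= n)%N -> symbolic_pow I n = ideal_pow I n).
Proof.
suff main n : Ass (ideal_pow I n) `<=` Ass I -> symbolic_pow I n = ideal_pow I n.
  by split=> [n _|ntf n n1]; [exact: main | exact/main/ntf].
set J := ideal_pow I n => assJ; have idJ : ideal J by exact: ideal_ideal_gen.
apply/seteqP; split=> x; last first.
  move=> Jx p [[_ p1 _] _]; exists 1%N, (fun=> 1), (fun=> tofrac x).
  split; last by rewrite big_ord1 mul1r.
  - by move=> _; exists 1, 1; rewrite divr1.
  - by move=> _; exists x.
move=> symx; apply: contrapT => nJx.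
have [y prime_p] := exists_prime_colon (@mpoly_acc K s) idJ nJx.
have assp : Ass I (colon J (x * y)) by apply: assJ; split=> //; exists (x * y).
have [b pb Jbx] := loc_ext_tofrac idJ prime_p (symx _ assp).
have [_ _ JM] := idJ.
by apply: pb; rewrite /colon /= mulrA mulrC; apply: JM.
Qed.
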